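(* Let $\mathcal H$ be a real separable Hilbert space, let $T:\mathcal H\to\mathcal H$ be $\alpha$-averaged for some $\alpha\in(0,1]$ with $\operatorname{fix}T\neq\emptyset$, and let $R=\mathrm{id}-T$. Consider the iterates $(x_k)_{k\in\mathbb N}$ generated by the SuperMann scheme (described in the context) and suppose that $(x_k)_{k\in\mathbb N}$ converges strongly to a point $x_\star$ at which $R$ is strictly differentiable, with derivative $JRx_\star$. Suppose further that there is a constant $D\ge0$ such that $\|d_k\|\le D\|Rx_k\|$ for all $k\in\mathbb N$, and that the directions satisfy the Dennis–Moré condition $$\lim_{k\to\infty}\frac{\|Rx_k+JRx_\star\,d_k\|}{\|d_k\|}=0 .$$ Then the directions $d_k$ are superlinear, i.e. $$\lim_{k\to\infty}\frac{\|R(x_k+d_k)\|}{\|Rx_k\|}=0 .$$ In particular, if either $c_0>0$ or $c_1>0$, then: (i) eventually, the stepsize $\tau_k=1$ is always accepted and safeguard updates $K_2$ are deactivated (i.e., the scheme reduces to $x_{k+1}=x_k+d_k$ for all $k$ large enough); (ii) $(Rx_k)_{k\in\mathbb N}$ converges $Q$-superlinearly (to $0$); (iii) $(x_k)_{k\in\mathbb N}$ converges $R$-superlinearly; (iv) if $c_0>0$, then $\mathbb N\setminus K_0$ is finite.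
   Context: An operator $T$ is nonexpansive if $\|Tx-Ty\|\le\|x-y\|$ for all $x,y\in\mathcal H$; it is $\alpha$-averaged, $\alpha\in(0,1)$, if $T=(1-\alpha)\mathrm{id}+\alpha S$ for some nonexpansive $S:\mathcal H\to\mathcal H$; $1$-averaged means nonexpansive. $\operatorname{fix}T=\{z: Tz=z\}$. $R$ is strictly differentiable at $\bar x$ if it is differentiable there with derivative $JR\bar x$ (a bounded linear operator) satisfying $\lim_{(y,z)\to(\bar x,\bar x),\,y\ne z}\frac{\|Ry-Rz-JR\bar x(y-z)\|}{\|y-z\|}=0$. $Q$-superlinear convergence of $(Rx_k)$ to $0$: $\|Rx_{k+1}\|/\|Rx_k\|\to0$. $R$-superlinear convergence of $(x_k)$ to $x_\star$: $\|x_k-x_\star\|\le\Delta_k$ for some positive sequence $\Delta_k\to0$ with $\Delta_{k+1}/\Delta_k\to0$. SuperMann scheme. Parameters: $x_0\in\mathcal H$, $c_0,c_1,q\in[0,1)$, $\beta,\sigma\in(0,1)$, $\lambda\in(0,1/\alpha)$. Initialize $\eta_0=r_{\rm safe}=\|Rx_0\|$, $k=0$. Step 1. If $Rx_k=0$, stop. Step 2. Choose an update direction $d_k\in\mathcal H$. Step 3 (blind update, $k\in K_0$). If $\|Rx_k\|\le c_0\eta_k$, set $\eta_{k+1}=\|Rx_k\|$, $x_{k+1}=w_k:=x_k+d_k$ (the full step, $\tau_k=1$), and go to step 6. Step 4. Otherwise set $\eta_{k+1}=\eta_k$ and $\tau_k=1$. Step 5. Let $w_k=x_k+\tau_kd_k$.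 (a) (educated update, $k\in K_1$) If $\|Rx_k\|\le r_{\rm safe}$ and $\|Rw_k\|\le c_1\|Rx_k\|$, set $x_{k+1}=w_k$, update $r_{\rm safe}=\|Rw_k\|+q^k$, and go to step 6. (b) (safeguard update, $k\in K_2$) Else, if $\rho_k:=\|Rw_k\|^2-2\alpha\langle Rw_k,w_k-x_k\rangle\ge\sigma\|Rw_k\|\|Rx_k\|$, set $x_{k+1}=x_k-\lambda\frac{\rho_k}{\|Rw_k\|^2}Rw_k$ and go to step 6; otherwise replace $\tau_k\gets\beta\tau_k$ and repeat step 5. Step 6. Set $k\gets k+1$ and go to step 1. $K_0,K_1,K_2$ are the sets of indices of blind, educated and safeguard iterations. Standing assumption: no solution is found in finitely many steps, i.e. $Rx_k\ne0$ for all $k$ and $Rw_k\neq0$ for all candidate points $w_k$. The Dennis–Moré condition presupposes $d_k\ne0$. *)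

(* Defs.v *)
From HB Require Import structures.
From mathcomp Require Import all_boot all_order all_algebra.
From mathcomp Require Import all_classical all_reals all_analysis.

Set Implicit Arguments.
Unset Strict Implicit.
Unset Printing Implicit Defensive.

Import Order.TTheory GRing.Theory Num.Theory.
Import numFieldNormedType.Exports.

Local Open Scope classical_set_scope.
Local Open Scope ring_scope.

Definition separable (X : topologicalType) : Prop :=
  exists D : set X, countable D /\ dense D.

(* A real Hilbert space is a [completeNormedModType] together with a symmetric
   positive definite bilinear form inducing its norm. *)
Definition induces_norm (R : realType) (H : normedModType R)
    (dot : {dot H for @idfun R}) : Prop :=
  forall x : H, dot x x = `|x| ^+ 2.

Definition nonexpansive (R : realType) (H : normedModType R) (T : H -> H)
    : Prop :=
  forall x y : H, `|T x - T y| <= `|x - y|.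

Definition averaged (R : realType) (H : normedModType R) (alpha : R)
    (T : H -> H) : Prop :=
  (0 < alpha < 1 /\
     exists S : H -> H, nonexpansive S /\
       forall x, T x = (1 - alpha) *: x + alpha *: S x)
  \/ (alpha = 1 /\ nonexpansive T).

Definition fixpoints (H : Type) (T : H -> H) : set H := [set z | T z = z].

Definition residual (R : realType) (H : normedModType R) (T : H -> H)
    : H -> H :=
  fun x => x - T x.

(* [differentiable] includes the continuity of the linear map ['d F xbar]. *)
Definition strictly_differentiable (R : realType) (H : normedModType R)
    (F : H -> H) (xbar : H) : Prop :=
  differentiable F xbar /\
  (fun p : H * H =>
     `|F p.1 - F p.2 - 'd F xbar (p.1 - p.2)| / `|p.1 - p.2|)
    @ within [set p : H * H | p.1 <> p.2] (nbhs (xbar, xbar)) --> (0 : R).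

Definition q_superlinear_to0 (R : realType) (H : normedModType R)
    (u : nat -> H) : Prop :=
  (u @ \oo --> (0 : H)) /\
  ((fun k => `|u k.+1| / `|u k|) @ \oo --> (0 : R)).

Definition r_superlinear_to (R : realType) (H : normedModType R)
    (x : nat -> H) (xs : H) : Prop :=
  exists Delta : nat -> R,
    [/\ forall k, 0 < Delta k,
        Delta @ \oo --> (0 : R),
        (fun k => Delta k.+1 / Delta k) @ \oo --> (0 : R) &
        forall k, `|x k - xs| <= Delta k].

Variant update : Set := Blind | Educated | Safeguard.

Section SuperMann.
Context (R : realType) (H : completeNormedModType R).
Context (dot : {dot H for @idfun R}).
Context (F : H -> H) (alpha c0 c1 q beta sigma lambda : R).

(* Candidate point after [j] backtrackings, i.e. for the stepsize beta ^ j. *)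
Definition candidate (x d : H) (j : nat) : H := x + beta ^+ j *: d.

Definition rho (x w : H) : R :=
  `|F w| ^+ 2 - 2 * alpha * dot (F w) (w - x).

Definition blind_test (eta : R) (x : H) : bool := `|F x| <= c0 * eta.

Definition educated_test (rsafe : R) (x w : H) : bool :=
  (`|F x| <= rsafe) && (`|F w| <= c1 * `|F x|).

Definition safeguard_test (x w : H) : bool :=
  sigma * `|F w| * `|F x| <= rho x w.

(* [supermann_step k d x eta rsafe u m x' eta' rsafe']: with direction [d],
   iteration [k] turns the state [(x, eta, rsafe)] into [(x', eta', rsafe')] by
   an update of kind [u] after exactly [m] stepsize reductions. *)
Variant supermann_step (k : nat) (d x : H) (eta rsafe : R) :
    update -> nat -> H -> R -> R -> Prop :=
  | BlindStep :
      blind_test eta x ->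
      supermann_step k d x eta rsafe Blind 0 (x + d) `|F x| rsafe
  | EducatedStep (m : nat) (w := candidate x d m) :
      ~~ blind_test eta x ->
      (forall j, (j < m)%N ->
         ~~ educated_test rsafe x (candidate x d j) /\
         ~~ safeguard_test x (candidate x d j)) ->
      educated_test rsafe x w ->
      supermann_step k d x eta rsafe Educated m w eta (`|F w| + q ^+ k)
  | SafeguardStep (m : nat) (w := candidate x d m) :
      ~~ blind_test eta x ->
      (forall j, (j < m)%N ->
         ~~ educated_test rsafe x (candidate x d j) /\
         ~~ safeguard_test x (candidate x d j)) ->
      ~~ educated_test rsafe x w ->
      safeguard_test x w ->
      supermann_step k d x eta rsafe Safeguard m
        (x - (lambda * (rho x w / `|F w| ^+ 2)) *: F w) eta rsafe.

Record supermann_run (x d : nat -> H) (eta rsafe tau : nat -> R)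
    (kind : nat -> update) (m : nat -> nat) : Prop := SuperMannRun {
  run_eta0 : eta 0%N = `|F (x 0%N)|;
  run_rsafe0 : rsafe 0%N = `|F (x 0%N)|;
  run_tau : forall k, tau k = beta ^+ m k;
  run_step : forall k,
    supermann_step k (d k) (x k) (eta k) (rsafe k) (kind k) (m k)
      (x k.+1) (eta k.+1) (rsafe k.+1)
}.

(* Neither an iterate nor a candidate tried by the scheme is a zero of [F]. *)
Definition no_finite_termination (x d : nat -> H) (m : nat -> nat) : Prop :=
  (forall k, F (x k) <> 0) /\
  (forall k j, (j <= m k)%N -> F (candidate (x k) (d k) j) <> 0).

End SuperMann.

Definition update_set (kind : nat -> update) (u : update) : set nat :=
  [set k | kind k = u].

(* Main.v *)
Require Import Defs.
From HB Require Import structures.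
From mathcomp Require Import all_boot all_order all_algebra.
From mathcomp Require Import all_classical all_reals all_analysis.
From mathcomp Require Import lra.

Set Implicit Arguments.
Unset Strict Implicit.
Unset Printing Implicit Defensive.

Import Order.TTheory GRing.Theory Num.Theory.
Import numFieldNormedType.Exports.

Local Open Scope classical_set_scope.
Local Open Scope ring_scope.

(** Write [F] for the residual and [r_k = |F x_k|].

    The limit [xs] of the iterates is a zero of [F] ([run_limit_zero]).
    Infinitely many blind or educated updates force infinitely many reductions
    of [r_k] by a factor [c0] or [c1] below one, and a safeguard update moves
    the iterate by at least [lambda * sigma * r_k], while the moves of a
    convergent sequence vanish.  So the limit of [r_k], which is [|F xs|] by
    continuity, is zero in every case.

    Since [|d_k| <= D * r_k] tends to [0], the trial points [x_k + d_k] also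
    converge to [xs].  Strict differentiability then compares [F (x_k + d_k)]
    with the linear model that the Dennis-More condition controls, and the
    directions are superlinear ([dennis_more_superlinear]).

    Superlinear directions make the scheme stay with full steps.  A blind update
    sets [eta] to [r_k], and an educated update sets [rsafe] to at least
    [r_(k+1)]; hence the same test succeeds at the next iteration once the
    full step decreases the residual by the factor [c0] or [c1].  Such an
    update does occur arbitrarily late: otherwise its positive reference value
    would be stationary, while [r_k] tends to zero
    ([blind_eventually], [educated_eventually]).

    The superlinear decrease of [r_k] follows at once, and summing the steps
    [|d_k| <= D * r_k] bounds the distance to the limit by a multiple of [r_k]
    ([full_steps_r_superlinear]). *)

(** * Sequences *)

(** This is how a single late update of one kind yields that all the later
    updates are of this kind. *)
Lemma near_persistent (P : nat -> Prop) :
  (\forall k \near \oo, P k -> P k.+1) ->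
  (\forall k \near \oo, P k) \/ (\forall k \near \oo, ~ P k).
Proof.
move=> [N _ step]; have [[k [Nk Pk]]|noP] := pselect (exists k, (N <= k)%N /\ P k).
  left; exists k => // n /= /subnK <-; elim: (n - k)%N => [//|i IH].
  by rewrite addSn; apply: step IH; rewrite /= (leq_trans Nk) ?leq_addl.
by right; exists N => // k /= Nk Pk; apply: noP; exists k.
Qed.

Lemma near_stationary (V : Type) (u : nat -> V) :
  (\forall k \near \oo, u k.+1 = u k) ->
  exists N, \forall k \near \oo, u k = u N.
Proof.
move=> [N _ step]; exists N, N => // n /= /subnK <-.
elim: (n - N)%N => [//|i IH]; rewrite addSn step //=.
by rewrite leq_addl.
Qed.

Lemma cvg_ratio_near (R : realType) (u v : nat -> R) (c : R) :
  0 < c -> (forall k, 0 < v k) ->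
  (fun k => u k / v k) @ \oo --> (0 : R) ->
  \forall k \near \oo, u k <= c * v k.
Proof.
move=> c0 v0 uv; near=> k; rewrite -ler_pdivrMr //.
by near: k; apply: cvgr_le uv _ c0.
Unshelve. all: by end_near. Qed.

(** Since [r] halves, [D * r_k <= 2 * D * (r_k - r_(k+1))], and these bounds on
    the steps telescope. *)
Lemma dist_limit_le_residual (R : realType) (V : normedModType R)
    (x : nat -> V) (xs : V) (r : nat -> R) (D : R) (N : nat) :
  0 <= D -> (forall k, 0 <= r k) -> x @ \oo --> xs ->
  (forall k, (N <= k)%N -> `|x k.+1 - x k| <= D * r k) ->
  (forall k, (N <= k)%N -> r k.+1 <= 2^-1 * r k) ->
  forall k, (N <= k)%N -> `|x k - xs| <= 2 * D * r k.
Proof.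
move=> D0 r0 xxs stepD halve k Nk.
have tele n : (k <= n)%N -> `|x k - x n| <= 2 * D * (r k - r n).
  move=> /subnK <-; elim: (n - k)%N => [|i IH].
    by rewrite add0n !subrr normr0 mulr0.
  have Nik : (N <= i + k)%N by rewrite (leq_trans Nk) ?leq_addl.
  have := stepD _ Nik; have := halve _ Nik; rewrite addSn distrC => h1 h2.
  have -> : x k - x (i + k).+1 = (x k - x (i + k)%N) + (x (i + k)%N - x (i + k).+1).
    by rewrite addrA subrK.
  apply: le_trans (ler_normD _ _) _; apply: le_trans (lerD IH h2) _.
  have := ler_wpM2l D0 h1; lra.
have cvgn : `|x k - x n| @[n --> \oo] --> `|x k - xs|.
  by apply: cvg_norm; apply: cvgB => //; exact: cvg_cst.
rewrite -(cvg_lim _ cvgn) //; apply: limr_le; first by apply/cvg_ex; exists `|x k - xs|.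
near=> n; apply: le_trans (tele n _) _; first by near: n; exists k.
by rewrite ler_wpM2l ?mulr_ge0 // gerBl.
Unshelve. all: by end_near. Qed.

(** * Superlinear directions *)

Lemma strictly_differentiable_cvg (R : realType) (H : normedModType R)
    (F : H -> H) (xs : H) (y z : nat -> H) :
  strictly_differentiable F xs -> y @ \oo --> xs -> z @ \oo --> xs ->
  (forall k, y k <> z k) ->
  (fun k => `|F (y k) - F (z k) - 'd F xs (y k - z k)| / `|y k - z k|)
    @ \oo --> (0 : R).
Proof.
move=> [_ lim0] yxs zxs yz.
apply: (cvg_comp (fun k => (y k, z k)) _ _ lim0) => A wA.
have : nbhs \oo [set k | y k <> z k -> A (y k, z k)].
  exact: (cvg_pair yxs zxs wA).
by apply: filterS => k; apply.
Qed.

(** By strict differentiability the linear model [F x_k + J d_k], which the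
    Dennis-More condition makes small, predicts [F (x_k + d_k)] up to
    [o(|d_k|)]; and [|d_k|] is at most [D * |F x_k|].  That [F xs = 0]
    is what forces [x_k + d_k] to converge to [xs]. *)
Lemma dennis_more_superlinear (R : realType) (H : normedModType R)
    (F : H -> H) (x d : nat -> H) (xs : H) (D : R) :
  strictly_differentiable F xs -> F xs = 0 -> x @ \oo --> xs ->
  (forall k, F (x k) <> 0) -> (forall k, d k <> 0) ->
  (forall k, `|d k| <= D * `|F (x k)|) ->
  (fun k => `|F (x k) + 'd F xs (d k)| / `|d k|) @ \oo --> (0 : R) ->
  (fun k => `|F (x k + d k)| / `|F (x k)|) @ \oo --> (0 : R).
Proof.
move=> sd Fxs0 xxs Fx0 d0 dD dm.
have Fx : (F \o x) @ \oo --> F xs.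
  exact: (cvg_comp _ _ xxs (differentiable_continuous sd.1)).
have dcvg : d @ \oo --> (0 : H).
  apply/norm_cvg0P; apply: (@squeeze_cvgr _ _ _ _ (cst 0) (fun k => D * `|F (x k)|)).
  - by near=> k; rewrite normr_ge0 dD.
  - exact: cvg_cst.
  - rewrite -(mulr0 D) -(normr0 H) -Fxs0.
    by apply: cvgM; [exact: cvg_cst|exact: cvg_norm].
have wxs : (fun k => x k + d k) @ \oo --> xs.
  by rewrite -[xs]addr0; apply: cvgD.
have err := strictly_differentiable_cvg sd wxs xxs.
have {err}/err : forall k, x k + d k <> x k.
  by move=> k; rewrite -[RHS]addr0 => /addrI; exact: d0.
move=> err.
have dE k : x k + d k - x k = d k by rewrite addrAC subrr add0r.
pose e k := `|F (x k + d k) - F (x k) - 'd F xs (d k)| +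
  `|F (x k) + 'd F xs (d k)|.
have bound : (fun k => D * (e k / `|d k|)) @ \oo --> (0 : R).
  rewrite -(mulr0 D) -(addr0 (0 : R)); apply: cvgM; first exact: cvg_cst.
  apply: cvg_trans (cvgD err dm); apply: near_eq_cvg; near=> k.
  by rewrite /e mulrDl -[LHS]/(_ / _ + _) dE.
apply: squeeze_cvgr (cvg_cst 0) bound; near=> k.
have rk : 0 < `|F (x k)| by rewrite normr_gt0; apply/eqP.
have dk : 0 < `|d k| by rewrite normr_gt0; apply/eqP.
rewrite /cst divr_ge0 //= ler_pdivrMr //; apply: (@le_trans _ _ (e k)).
  have -> : F (x k + d k) = (F (x k + d k) - F (x k) - 'd F xs (d k))
                            + (F (x k) + 'd F xs (d k)).
    by rewrite addrACA addNr addr0 subrK.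
  exact: ler_normD.
rewrite -[leLHS](divfK (lt0r_neq0 dk)) [D * _]mulrC -(mulrA _ D).
by apply: ler_wpM2l => //; rewrite divr_ge0 ?addr_ge0.
Unshelve. all: by end_near. Qed.

(** * Runs of the scheme *)

Section Run.
Context (R : realType) (H : completeNormedModType R).
Context (dot : {dot H for @idfun R}).
Context (F : H -> H) (alpha c0 c1 q beta sigma lambda : R).

Local Notation step :=
  (supermann_step dot F alpha c0 c1 q beta sigma lambda).

Lemma candidate0 (x d : H) : candidate beta x d 0 = x + d.
Proof. by rewrite /candidate expr0 scale1r. Qed.

Lemma step_blind_test k d x eta rsafe u m x' eta' rsafe' :
  step k d x eta rsafe u m x' eta' rsafe' ->
  blind_test F c0 eta x -> u = Blind.
Proof. by case=> // [m0 w /negP + _ _|m0 w /negP + _ _ _]. Qed.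

Lemma step_blind k d x eta rsafe u m x' eta' rsafe' :
  step k d x eta rsafe u m x' eta' rsafe' -> u = Blind ->
  [/\ blind_test F c0 eta x, m = 0%N, x' = x + d & eta' = `|F x|].
Proof. by case. Qed.

Lemma step_nonblind k d x eta rsafe u m x' eta' rsafe' :
  step k d x eta rsafe u m x' eta' rsafe' -> u <> Blind -> eta' = eta.
Proof. by case. Qed.

Lemma step_educated k d x eta rsafe u m x' eta' rsafe' :
  step k d x eta rsafe u m x' eta' rsafe' -> u = Educated ->
  [/\ educated_test F c1 rsafe x x', x' = candidate beta x d m &
      rsafe' = `|F x'| + q ^+ k].
Proof. by case. Qed.

Lemma step_noneducated k d x eta rsafe u m x' eta' rsafe' :
  step k d x eta rsafe u m x' eta' rsafe' -> u <> Educated -> rsafe' = rsafe.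
Proof. by case. Qed.

(** Backtracking past the full step means that its educated test has failed. *)
Lemma step_educated_full k d x eta rsafe u m x' eta' rsafe' :
  step k d x eta rsafe u m x' eta' rsafe' -> u <> Blind ->
  educated_test F c1 rsafe x (x + d) -> u = Educated /\ m = 0%N.
Proof.
case=> // [m0 w _ prev _ _ full|m0 w _ prev + _ _ full].
  case: m0 @w prev => [//|m0] _ prev.
  by have [] := prev 0%N isT; rewrite candidate0 full.
case: m0 @w prev => [|m0] w prev; first by rewrite /w candidate0 full.
by have [] := prev 0%N isT; rewrite candidate0 full.
Qed.

(** A safeguard update moves by [lambda * rho / |F w|], and the test it passed
    says that [rho / |F w|] is at least [sigma * |F x|]. *)
Lemma step_safeguard_move k d x eta rsafe u m x' eta' rsafe' :
  0 <= lambda -> F (candidate beta x d m) <> 0 ->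
  step k d x eta rsafe u m x' eta' rsafe' -> u = Safeguard ->
  lambda * sigma * `|F x| <= `|x' - x|.
Proof.
move=> l0 Fw0 st; case: st Fw0 => // {}m w _ _ _ test /eqP Fw0 _.
have Fw : 0 < `|F w| by rewrite normr_gt0.
rewrite addrAC subrr add0r normrN normrZ normrM (ger0_norm l0).
rewrite -mulrA -[leRHS]mulrA; apply: ler_wpM2l => //.
rewrite normrM normfV normrX normr_id expr2 invfM mulrA divfK ?gt_eqF //.
rewrite ler_pdivlMr // mulrAC.
exact: le_trans test (ler_norm _).
Qed.

Context (x d : nat -> H) (eta rsafe tau : nat -> R).
Context (kind : nat -> update) (m : nat -> nat) (xs : H).
Hypothesis run : supermann_run dot F alpha c0 c1 q beta sigma lambda
  x d eta rsafe tau kind m.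
Hypothesis no_stop : no_finite_termination F beta x d m.

Let stp := run_step run.

Lemma residual_gt0 k : 0 < `|F (x k)|.
Proof. by rewrite normr_gt0; apply/eqP; case: no_stop. Qed.

Lemma eta_gt0 k : 0 < eta k.
Proof.
elim: k => [|k IH]; first by rewrite (run_eta0 run) residual_gt0.
have [/(step_blind (stp k))[_ _ _ ->]|/(step_nonblind (stp k)) ->//] :=
  pselect (kind k = Blind).
exact: residual_gt0.
Qed.

Lemma rsafe_gt0 k : 0 <= q -> 0 < rsafe k.
Proof.
move=> q0; elim: k => [|k IH]; first by rewrite (run_rsafe0 run) residual_gt0.
have [/(step_educated (stp k))[_ _ ->]|/(step_noneducated (stp k)) ->//] :=
  pselect (kind k = Educated).
by rewrite ltr_pwDl ?exprn_ge0 ?residual_gt0.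
Qed.

(** If the residual had a nonzero limit, then eventually no residual would be
    at most [c1] times the previous one, which excludes educated updates, nor
    at most [c0] times an earlier one, which excludes blind updates; and
    safeguard updates are excluded because their moves would stay bounded away
    from zero. *)
Lemma run_limit_zero :
  c0 < 1 -> c1 < 1 -> 0 < sigma -> 0 < lambda ->
  x @ \oo --> xs -> {for xs, continuous F} -> F xs = 0.
Proof.
move=> c01 c11 s0 l0 xxs Fc; apply/eqP; rewrite -normr_eq0; apply/negP => /negP rn0.
set r := `|F xs| in rn0.
have r0 : 0 < r by rewrite lt0r rn0 normr_ge0.
have rcvg : (fun k => `|F (x k)|) @ \oo --> r.
  by apply: cvg_norm; exact: (cvg_comp _ _ xxs Fc).
have scvg : (fun k => x k.+1) @ \oo --> xs by rewrite cvg_shiftS.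
have rScvg : (fun k => `|F (x k.+1)|) @ \oo --> r.
  by apply: cvg_norm; exact: (cvg_comp _ _ scvg Fc).
have gap c : c < 1 -> exists2 s, c * r < s & s < r.
  by move=> c_1; exists ((c * r + r) / 2); have := ltr_pM2r r0 c 1; rewrite c_1; lra.
have mulcvg c : (fun k => c * `|F (x k)|) @ \oo --> c * r.
  by apply: cvgM => //; exact: cvg_cst.
have noE : \forall k \near \oo, kind k <> Educated.
  have [s cs sr] := gap _ c11.
  near=> k => /(step_educated (stp k))[/andP[_ +] _ _].
  apply/negP; rewrite -ltNge (@lt_trans _ _ s) //; near: k.
    exact: cvgr_lt (mulcvg _) _ cs.
  exact: cvgr_gt rScvg _ sr.
have noB : \forall k \near \oo, kind k <> Blind.
  have [s cs sr] := gap _ c01.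
  have big : \forall k \near \oo, s < `|F (x k)| by exact: cvgr_gt rcvg _ sr.
  have small : \forall k \near \oo, c0 * `|F (x k)| < s.
    exact: cvgr_lt (mulcvg _) _ cs.
  have refuse k : s < `|F (x k)| -> c0 * eta k < s -> kind k <> Blind.
    move=> sk ek /(step_blind (stp k))[+ _ _ _]; apply/negP.
    by rewrite -ltNge (lt_trans ek).
  (* Once [c0 * eta] is below [s], blind updates are rejected and [eta] stays
     put; and any late blind update brings it there. *)
  have [|low|high] := @near_persistent (fun k => c0 * eta k < s).
  - near=> k => ek; rewrite (step_nonblind (stp k)) //.
    by apply: refuse => //; near: k.
  - by near=> k; apply: refuse; near: k.
  - have /= highS : \forall k \near \oo, ~ c0 * eta k.+1 < s.
      by case: high => N _ hN; exists N => // k /= Nk; apply: hN; exact: leqW.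
    near=> k => /(step_blind (stp k))[_ _ _ ek].
    have := near highS k; rewrite ek; apply => //.
      by near: k; exact: small.
have : lambda * sigma * r <= 0.
  have move0 : `|x k.+1 - x k| @[k --> \oo] --> (0 : R).
    by rewrite -(normr0 H) -(subrr xs); apply: cvg_norm; exact: cvgB.
  apply: ler_cvg_to (mulcvg _) move0 _; near=> k.
  apply: (step_safeguard_move (ltW l0) _ (stp k)); first by case: no_stop => _; apply.
  have : kind k <> Educated by near: k.
  have : kind k <> Blind by near: k.
  by case: (kind k).
by rewrite leNgt !mulr_gt0.
Unshelve. all: by end_near. Qed.

Hypothesis residual0 : (fun k => `|F (x k)|) @ \oo --> (0 : R).
Hypothesis superlinear :
  (fun k => `|F (x k + d k)| / `|F (x k)|) @ \oo --> (0 : R).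

(** The reference [eta] cannot stagnate, since the residual would fall below
    [c0 * eta]; and a blind update at [k] sets [eta] to [|F x_k|], against
    which the superlinear decrease makes the next test succeed. *)
Lemma blind_eventually : 0 < c0 -> \forall k \near \oo, kind k = Blind.
Proof.
move=> c00; have dec := cvg_ratio_near c00 residual_gt0 superlinear.
have [|//|noB] := @near_persistent (fun k => kind k = Blind).
  near=> k => /(step_blind (stp k))[_ _ xk ek].
  apply: (step_blind_test (stp k.+1)); rewrite /blind_test xk ek.
  by near: k.
(* Without blind updates [eta] is eventually a positive constant, and the test
   succeeds as soon as the residual is small enough. *)
have [|N stat] := @near_stationary _ eta.
  by apply: filterS noB => k; exact: (step_nonblind (stp k)).
suff : \forall k \near \oo, False by move=> [n _ /(_ n)]; case=> /=.
near=> k; have : kind k <> Blind by near: k.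
apply; apply: (step_blind_test (stp k)); rewrite /blind_test.
have -> : eta k = eta N by near: k.
by near: k; apply: cvgr_le residual0 _ _; rewrite mulr_gt0 ?eta_gt0.
Unshelve. all: by end_near. Qed.

(** The same two arguments with [rsafe] in place of [eta]: an educated update
    resets [rsafe] to at least the new residual. *)
Lemma educated_eventually : c0 = 0 -> 0 <= q -> 0 < c1 ->
  \forall k \near \oo, kind k = Educated /\ m k = 0%N.
Proof.
move=> c00 q0 c10; have dec := cvg_ratio_near c10 residual_gt0 superlinear.
have noB k : kind k <> Blind.
  move=> /(step_blind (stp k))[+ _ _ _]; apply/negP.
  by rewrite /blind_test c00 mul0r -ltNge residual_gt0.
have full : \forall k \near \oo,
    `|F (x k)| <= rsafe k -> kind k = Educated /\ m k = 0%N.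
  near=> k => rk; apply: (step_educated_full (stp k)) => //.
  by rewrite /educated_test rk /=; near: k.
have fullS : \forall k \near \oo,
    `|F (x k.+1)| <= rsafe k.+1 -> kind k.+1 = Educated.
  by case: full => N _ hN; exists N => // k /= Nk /(hN _ (leqW Nk))[].
have [|E|noE] := @near_persistent (fun k => kind k = Educated).
- near=> k => /(step_educated (stp k))[_ _ rS].
  suff : `|F (x k.+1)| <= rsafe k.+1 by near: k.
  by rewrite rS lerDl exprn_ge0.
- near=> k; have Ek : kind k = Educated by near: k.
  suff : `|F (x k)| <= rsafe k by near: k.
  by have [/andP[]] := step_educated (stp k) Ek.
have [|N stat] := @near_stationary _ rsafe.
  by apply: filterS noE => k; exact: (step_noneducated (stp k)).
suff : \forall k \near \oo, False by move=> [n _ /(_ n)]; case=> /=.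
near=> k; have : kind k <> Educated by near: k.
apply; suff /(near full k) [] : `|F (x k)| <= rsafe k by [].
have -> : rsafe k = rsafe N by near: k.
by near: k; apply: cvgr_le residual0 _ _; exact: rsafe_gt0.
Unshelve. all: by end_near. Qed.

Lemma full_steps_eventually : 0 <= c0 -> 0 <= q -> 0 < c0 \/ 0 < c1 ->
  \forall k \near \oo,
    [/\ tau k = 1, kind k <> Safeguard & x k.+1 = x k + d k].
Proof.
move=> c00 q0 c01.
have [c0gt|c0le] := ltP 0 c0.
  apply: filterS (blind_eventually c0gt) => k Bk.
  have [_ mk xk _] := step_blind (stp k) Bk.
  by rewrite (run_tau run) mk expr0 Bk.
have c0E : c0 = 0 by apply/eqP; rewrite eq_le c0le.
have c1gt : 0 < c1 by case: c01 => //; rewrite c0E ltxx.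
apply: filterS (educated_eventually c0E q0 c1gt) => k [Ek mk].
have [_ xk _] := step_educated (stp k) Ek.
by rewrite (run_tau run) xk mk candidate0 expr0 Ek.
Qed.

End Run.

(** Once the residual halves at every step, [2 * D * |F x_k|] bounds the
    distance to the limit and inherits the superlinear rate.  [D + 1] keeps the
    bound positive, and the finitely many earlier distances are added to it. *)
Lemma full_steps_r_superlinear (R : realType) (H : normedModType R)
    (F : H -> H) (x d : nat -> H) (xs : H) (D : R) :
  x @ \oo --> xs -> (forall k, F (x k) <> 0) -> 0 <= D ->
  (forall k, `|d k| <= D * `|F (x k)|) ->
  (\forall k \near \oo, x k.+1 = x k + d k) ->
  q_superlinear_to0 (fun k => F (x k)) ->
  r_superlinear_to x xs.
Proof.
move=> xxs Fx0 D0 dD full [Fx ratio].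
have r0 k : 0 < `|F (x k)| by rewrite normr_gt0; apply/eqP.
have half0 : (0 : R) < 2^-1 by rewrite invr_gt0.
have [N _ fh] := filterI full (cvg_ratio_near half0 r0 ratio).
have bound k : (N <= k)%N -> `|x k - xs| <= 2 * D * `|F (x k)|.
  apply: (dist_limit_le_residual (r := fun k => `|F (x k)|) D0 _ xxs) => {k}//.
  - by move=> k /fh[/= -> _]; rewrite [x k + _]addrC addrK.
  - by move=> k /fh[].
pose Delta k := 2 * (D + 1) * `|F (x k)| + (if (N <= k)%N then 0 else `|x k - xs|).
have D1 : 0 < 2 * (D + 1) by lra.
have DeltaE k : (N <= k)%N -> Delta k = 2 * (D + 1) * `|F (x k)|.
  by rewrite /Delta => ->; rewrite addr0.
exists Delta; split.
- move=> k; rewrite /Delta ltr_pwDl ?(mulr_gt0 D1 (r0 k)) //.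
  by case: (N <= k)%N.
- have scaled : (fun k => 2 * (D + 1) * `|F (x k)|) @ \oo --> (0 : R).
    rewrite (_ : 0 = 2 * (D + 1) * `|0 : H|); last by rewrite normr0 mulr0.
    apply: cvgM; first exact: cvg_cst.
    exact: cvg_norm.
  apply: cvg_trans scaled; apply: near_eq_cvg; exists N => // k /= Nk.
  by rewrite DeltaE.
- apply: cvg_trans ratio; apply: near_eq_cvg; exists N => // k /= Nk.
  rewrite !DeltaE ?(leqW Nk) // -mulf_div divff ?mul1r //.
  by rewrite gt_eqF.
- move=> k; rewrite /Delta; case: ifPn => Nk.
    rewrite addr0; apply: le_trans (bound _ Nk) _; have := r0 k; lra.
  by rewrite lerDr mulr_ge0 // ltW.
Qed.

Theorem mainTheorem7 (R : realType) (H : completeNormedModType R)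
    (dot : {dot H for @idfun R}) (dot_norm : induces_norm dot)
    (H_separable : separable H)
    (T : H -> H) (alpha : R) (alpha_bounds : 0 < alpha <= 1)
    (T_averaged : averaged alpha T)
    (fixT : fixpoints T !=set0)
    (c0 c1 q beta sigma lambda : R)
    (c0_bounds : 0 <= c0 < 1) (c1_bounds : 0 <= c1 < 1)
    (q_bounds : 0 <= q < 1)
    (beta_bounds : 0 < beta < 1) (sigma_bounds : 0 < sigma < 1)
    (lambda_bounds : 0 < lambda < alpha^-1)
    (x d : nat -> H) (eta rsafe tau : nat -> R)
    (kind : nat -> update) (m : nat -> nat)
    (run : supermann_run dot (residual T) alpha c0 c1 q beta sigma lambda
             x d eta rsafe tau kind m)
    (no_stop : no_finite_termination (residual T) beta x d m)
    (xs : H) (x_cvg : x @ \oo --> xs)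
    (strict_diff : strictly_differentiable (residual T) xs)
    (D : R) (D_ge0 : 0 <= D)
    (d_bound : forall k, `|d k| <= D * `|residual T (x k)|)
    (d_neq0 : forall k, d k <> 0)
    (dennis_more :
      (fun k => `|residual T (x k) + 'd (residual T) xs (d k)| / `|d k|)
        @ \oo --> (0 : R)) :
  ((fun k => `|residual T (x k + d k)| / `|residual T (x k)|)
     @ \oo --> (0 : R)) /\
  (0 < c0 \/ 0 < c1 ->
    [/\ \forall k \near \oo,
          [/\ tau k = 1, ~ update_set kind Safeguard k & x k.+1 = x k + d k],
        q_superlinear_to0 (fun k => residual T (x k)),
        r_superlinear_to x xs &
        0 < c0 -> finite_set (~` update_set kind Blind)]).
Proof.
have [Fx_neq0 _] := no_stop.
have [q0 _] := andP q_bounds; have [c00 c01] := andP c0_bounds.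
have [_ c11] := andP c1_bounds; have [s0 _] := andP sigma_bounds.
have [l0 _] := andP lambda_bounds.
have Fcont := differentiable_continuous strict_diff.1.
have Fxs0 := run_limit_zero run no_stop c01 c11 s0 l0 x_cvg Fcont.
have Fx_cvg : residual T (x k) @[k --> \oo] --> (0 : H).
  by rewrite -Fxs0; exact: (cvg_comp _ _ x_cvg Fcont).
have Fx_norm : `|residual T (x k)| @[k --> \oo] --> (0 : R) by apply/norm_cvg0P.
have superlin := dennis_more_superlinear strict_diff Fxs0 x_cvg Fx_neq0 d_neq0
  d_bound dennis_more.
split=> // c_gt0.
have full := full_steps_eventually run no_stop Fx_norm superlin c00 q0 c_gt0.
have fullx : \forall k \near \oo, x k.+1 = x k + d k.
  by apply: filterS full => k [].
have qsup : q_superlinear_to0 (fun k => residual T (x k)).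
  split=> //; apply: cvg_trans superlin; apply: near_eq_cvg.
  by apply: filterS fullx => k ->.
split=> //.
- exact: full_steps_r_superlinear x_cvg Fx_neq0 D_ge0 d_bound fullx qsup.
- move=> c0_gt0.
  have [N _ allB] := blind_eventually run no_stop Fx_norm superlin c0_gt0.
  apply: (sub_finite_set _ (finite_II N)) => k nB; rewrite /= ltnNge.
  by apply/negP => /allB.
Qed.
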